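(* Let $(\Omega,\rho)$ be a doubling metric space, let $A\subseteq\Omega$ be a finite nonempty set, and let $R:A\to(0,\infty)$ be a function such that $A$ is $R$-separated, i.e., for every $a\in A$, $\inf_{a'\in A\setminus\{a\}}\rho(a,a')>R(a)$. Let $\bar r:=|A|^{-1}\sum_{a\in A}R(a)$ be the average separation radius. Then $$|A|\le\left(\frac{5\operatorname{diam}(A)}{\bar r}\right)^{\min\{\operatorname{ddim}(A),\,\operatorname{ddim}(\Omega)\}}.$$
   Context: For a metric space $(X,\rho)$, $x\in X$ and $r>0$, the closed $r$-ball about $x$ is $B(x,r)=\{x'\in X:\rho(x,x')\le r\}$. The space $(X,\rho)$ is doubling if there is $D<\infty$ such that, for every $r>0$, every $r$-ball in $X$ is contained in the union of some $D$ balls of radius $r/2$ in $X$ (with centers in $X$). Its doubling dimension is $\operatorname{ddim}(X)=\log_2 D^*$, where $D^*$ is the smallest $D$ with this property. For a subset $A\subseteq\Omega$, $\operatorname{ddim}(A)$ is the doubling dimension of $A$ as a metric space in its own right with the restricted metric, so ball centers are taken in $A$. The diameter is $\operatorname{diam}(A)=\sup_{x,x'\in A}\rho(x,x')$. Conventions: the infimum over the empty set is $+\infty$, and $0^0=1$ (relevant only when $A$ is a singleton). *)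

(* Defs.v *)
From HB Require Import structures.
From mathcomp Require Import all_boot all_order all_algebra finmap.
From mathcomp Require Import all_classical all_reals all_analysis.

Set Implicit Arguments.
Unset Strict Implicit.
Unset Printing Implicit Defensive.

Import Order.TTheory GRing.Theory Num.Theory.

Local Open Scope classical_set_scope.
Local Open Scope ring_scope.

(* A finite subset of a metric space, as a metric space in its own right. *)
Section fset_metric.
Variables (K : realType) (T : metricType K) (A : {fset T}).

Let dist (a b : A) : K := mdist (val a) (val b).

Let distxx (a : A) : dist a a = 0.
Proof. exact: mdistxx. Qed.

Let dist_positivity (a b : A) : dist a b = 0 -> a = b.
Proof. by move=> /mdist_positivity /val_inj. Qed.

Let dist_sym (a b : A) : dist a b = dist b a.
Proof. exact: metric_sym. Qed.

Let dist_triangle (b a c : A) : dist a c <= dist a b + dist b c.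
Proof. exact: metric_triangle. Qed.

HB.instance Definition _ := @isMetric.Build K (fset_sub_type A) dist
  distxx dist_positivity dist_sym dist_triangle.

Lemma fset_mdistE (a b : A) : mdist a b = mdist (val a) (val b).
Proof. by []. Qed.

End fset_metric.

(* MathComp-Analysis's [ball] is open and its [closed_ball] is the closure of
   the open ball, which can be smaller than the set below. *)
Definition cball (K : realType) (X : metricType K) (x : X) (r : K) : set X :=
  [set y | mdist x y <= r].

Definition doubling_with (K : realType) (X : metricType K) (D : nat) : Prop :=
  forall (x : X) (r : K), 0 < r ->
    exists c : 'I_D -> X, cball x r `<=` \bigcup_i cball (c i) (r / 2).

Definition doubling (K : realType) (X : metricType K) : Prop :=
  exists D : nat, doubling_with X D.

(* The value 0 outside doubling spaces is a placeholder. *)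
Definition doubling_const (K : realType) (X : metricType K) : nat :=
  if pselect (exists D, `[< doubling_with X D >]) is left exD
  then ex_minn exD else 0%N.

Definition ddim (K : realType) (X : metricType K) : K :=
  ln (doubling_const X)%:R / ln 2.

(* A real supremum: meaningful for bounded nonempty sets. *)
Definition diam (K : realType) (X : metricType K) (S : set X) : K :=
  sup [set mdist p.1 p.2 | p in S `*` S].

(* The infimum is taken in the extended reals, so it is +oo when A = {a}. *)
Definition radius_separated (K : realType) (T : metricType K) (A : {fset T})
    (R : A -> K) : Prop :=
  forall a : A,
    ((R a)%:E < ereal_inf [set (mdist a a')%:E | a' in [set a' | a' != a]])%E.

Definition avg_radius (K : realType) (T : metricType K) (A : {fset T})
    (R : A -> K) : K :=
  (#|` A|%:R)^-1 * \sum_(a : A) R a.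

(* Main.v *)
Require Import Defs.
From mathcomp Require Import all_boot all_order all_algebra finmap.
From mathcomp Require Import all_classical all_reals all_analysis.
From mathcomp Require Import ring lra.

(** Let [X] be a doubling space containing [A], let [D = 2 ^ d] be its doubling
    constant, so that [d] is its dimension, and let [r] be the diameter of [A].
    The theorem is a Kraft inequality followed by Jensen's inequality.

    Kraft inequality ([sum_powR_le]): if the points of [A] lie in a ball of
    radius [r], then the sum of the [R a ^ d] is at most [(4 r) ^ d]. Cover the
    ball by [D] balls of half the radius and assign each point to one of them.
    This refines into a [D]-ary tree in which a branch stops as soon as its cell
    contains at most one point. A point that still shares a ball of radius
    [r / 2 ^ k] with another one has [R a < 2 r / 2 ^ k], so the level [k] at
    which [a] becomes isolated satisfies [(R a) ^ d <= (4 r) ^ d / D ^ k], and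
    the weights [D ^ - k] of the leaves of the tree add up to at most 1.

    Jensen's inequality ([card_powR_mean_le]): for [1 <= d], the function
    [x ^ d] is convex, so [#|A|] times the [d]-th power of the average radius is
    at most the sum of the [R a ^ d]. Exponents in ]0, 1[ would reverse this,
    but they do not occur: [D] is a positive integer, so [d] is 0 or at least 1
    ([ddim_dichotomy]), and both sides equal [#|A|] when [d = 0].

    Together these give the bound with 4 in place of 5 ([card_le_powR_ddim]).
    The centers of the balls may be any points of [X], so the argument applies
    both to [X = A] and to [X = Omega], which gives the minimum of the two
    dimensions. If [A] is a singleton its diameter is 0 and there is no initial
    ball of positive radius; then [ddim A = 0] and the right-hand side is
    [0 ^ 0 = 1]. *)

Import Order.TTheory GRing.Theory Num.Theory.

Local Open Scope classical_set_scope.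
Local Open Scope ring_scope.

Lemma doubling_with_gt0 (K : realType) (X : metricType K) (D : nat) (x : X) :
  doubling_with X D -> (0 < D)%N.
Proof.
case: D => // /(_ x 1 ltr01) [c]; move=> /(_ x).
by case=> [|[]//]; rewrite /cball/= mdistxx ler01.
Qed.

Lemma doubling_constP (K : realType) (X : metricType K) :
  doubling X -> doubling_with X (doubling_const X).
Proof.
move=> [D hD]; rewrite /doubling_const; case: pselect => [exD|[]].
  by case: ex_minnP => m /asboolP.
by exists D; apply/asboolP.
Qed.

Lemma doubling_const_le (K : realType) (X : metricType K) (D : nat) :
  doubling_with X D -> (doubling_const X <= D)%N.
Proof.
move=> hD; rewrite /doubling_const; case: pselect => [exD|//].
by case: ex_minnP => m _; apply; apply/asboolP.
Qed.

(** Nonemptiness of [X] matters here: for the empty space the doubling constant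
    is 0, and [ln 0 = 0] would give the value 1 on the left. *)
Lemma powR_ddim (K : realType) (X : metricType K) (x : X) :
  doubling X -> 2 `^ ddim X = (doubling_const X)%:R :> K.
Proof.
move=> /doubling_constP/(doubling_with_gt0 _ _ _ x) D0.
rewrite /powR /ddim pnatr_eq0/= divfK ?lnK ?posrE ?ltr0n//.
by rewrite gt_eqF// ln_gt0// ltr1n.
Qed.

(** The doubling constant of a nonempty space is a positive integer, so its
    binary logarithm skips ]0, 1[, where [x ^ d] fails to be convex. *)
Lemma ddim_dichotomy (K : realType) (X : metricType K) (x : X) :
  doubling X -> ddim X = 0 \/ 1 <= ddim X.
Proof.
move=> /doubling_constP/(doubling_with_gt0 _ _ _ x); rewrite /ddim.
case: (doubling_const X) => [//|[|n]] _; first by left; rewrite ln1 mul0r.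
by right; rewrite ler_pdivlMr ?mul1r ?ler_ln ?posrE ?ler_nat// ln_gt0// ltr1n.
Qed.

Lemma ddim_ge0 (K : realType) (X : metricType K) (x : X) :
  doubling X -> 0 <= ddim X.
Proof. by move=> /(ddim_dichotomy _ _ x)[->//|]; apply: le_trans. Qed.

Lemma doubling_finite (K : realType) (T : metricType K) (A : {fset T}) :
  doubling_with A #|` A|.
Proof.
rewrite cardfE => x r r0; exists enum_val => y _; exists (enum_rank y) => //.
by rewrite /cball/= enum_rankK mdistxx divr_ge0// ltW.
Qed.

(** The Kraft inequality. For the induction on the scale, the hypothesis
    [R i <= 4 * r] takes care of cells with a single point. In a cell with two
    points, separation forces [R i <= 2 * r], which is that hypothesis for the
    balls of radius [r / 2]; summing over the [D = 2 ^ d] of them turns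
    [(2 * r) ^ d] into [(4 * r) ^ d]. The number [n] bounds the depth of the
    tree: once [2 * r] is below every [R i], no cell has two points. *)
Lemma sum_powR_le (K : realType) (X : metricType K) (D : nat) (d : K)
    (I : finType) (f : I -> X) (R : I -> K) :
  doubling_with X D -> 2 `^ d = D%:R -> 0 <= d ->
  (forall i, 0 < R i) ->
  (forall i j, i != j -> R i < mdist (f i) (f j)) ->
  forall (n : nat) (P : pred I) (x : X) (r : K), 0 < r ->
    (forall i, P i -> cball x r (f i)) ->
    (forall i, P i -> R i <= 4 * r) ->
    (forall i, P i -> 2 * r <= 2 ^+ n * R i) ->
  \sum_(i | P i) R i `^ d <= (4 * r) `^ d.
Proof.
move=> hD dD d0 R0 sepR.
have single (P : pred I) i s : P i -> [pred j | P j && (j != i)] =1 xpred0 ->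
    R i <= s -> \sum_(i | P i) R i `^ d <= s `^ d.
  move=> Pi P1 Ris; rewrite (big_pred1 i) => [|k].
    by rewrite ge0_ler_powR ?nnegrE ?(le_trans (ltW (R0 i)) Ris)// ltW.
  by have /= := P1 k; case: eqVneq => [->//|]; rewrite andbT.
elim=> [|n IH] P x r r0 Px R4 Rn;
  (case: (pickP P) => [i Pi|P0]; last by rewrite big_pred0 ?powR_ge0);
  (case: (pickP [pred j | P j && (j != i)]) => [j /=/andP[Pj ji]|P1];
    last exact: single Pi P1 (R4 i Pi)).
  have := Rn i Pi; have := sepR i j; rewrite eq_sym ji => /(_ isT).
  have := metric_triangle (f i) x (f j); rewrite (metric_sym (f i) x).
  have /= := Px i Pi; have /= := Px j Pj; rewrite /cball/= expr0 mul1r; lra.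
have R2 k : P k -> R k <= 2 * r.
  (* [k] itself may be [i] or [j]; the other one is then a distinct point of
     the cell. *)
  move=> Pk; have [l [Pl kl]] : exists l, P l /\ k != l.
    by have [->|ki] := eqVneq k i; [exists j; rewrite eq_sym|exists i].
  have := sepR k l kl.
  have := metric_triangle (f k) x (f l); rewrite (metric_sym (f k) x).
  have /= := Px k Pk; have /= := Px l Pl; rewrite /cball/=; lra.
have [c hc] := hD x r r0.
have D0 := doubling_with_gt0 _ _ _ x hD.
have /choice[p hp] : forall k, exists m : 'I_D, P k -> cball (c m) (r / 2) (f k).
  move=> k; have [Pk|Pk] := boolP (P k); last by exists (Ordinal D0).
  by have [m _ hm] := hc _ (Px k Pk); exists m.
rewrite (partition_big p xpredT)//=.
apply: (@le_trans _ _ (\sum_(m < D) (4 * (r / 2)) `^ d)).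
  apply: ler_sum => m _; apply: (IH _ (c m)).
  - by rewrite divr_gt0.
  - by move=> k /andP[Pk /eqP <-]; exact: hp.
  - by move=> k /andP[/R2 + _]; lra.
  - by move=> k /andP[/Rn + _]; rewrite exprS; lra.
rewrite sumr_const card_ord -[leLHS]mulr_natl -dD -powRM ?mulr_ge0 ?divr_ge0 ?(ltW r0)//.
by have -> : 2 * (4 * (r / 2)) = 4 * r by field.
Qed.

(** This is Young's inequality [x * 1 <= x ^ d / d + 1 / q] for the exponent
    [q = d / (d - 1)] conjugate to [d], multiplied by [d]. The endpoint [d = 1],
    where [q] is infinite, is treated separately. *)
Lemma powR_bernoulli (K : realType) (d x : K) :
  1 <= d -> 0 <= x -> 1 + d * (x - 1) <= x `^ d.
Proof.
rewrite le_eqVlt => /predU1P[<- x0|d1 x0]; first by rewrite powRr1//; lra.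
have d0 : 0 < d by lra.
have := @conjugate_powR _ x 1 d (d / (d - 1)) x0 ler01 d0.
rewrite divr_gt0// ?subr_gt0// => /(_ isT).
have -> : d^-1 + (d / (d - 1))^-1 = 1 by field; rewrite !gt_eqF// subr_gt0.
move=> /(_ erefl); rewrite powR1 mulr1 => h.
have : d * x <= d * (x `^ d / d + 1 / (d / (d - 1))) by rewrite ler_pM2l.
have -> : d * (x `^ d / d + 1 / (d / (d - 1))) = x `^ d + (d - 1).
  by field; rewrite !gt_eqF// subr_gt0.
lra.
Qed.

Lemma mean_gt0 (K : realType) (I : finType) (R : I -> K) :
  (0 < #|I|)%N -> (forall i, 0 < R i) -> 0 < #|I|%:R^-1 * \sum_i R i.
Proof.
move=> I0 R0; rewrite mulr_gt0 ?invr_gt0 ?ltr0n//; case/card_gt0P: I0 => i _.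
by rewrite (bigD1 i)//= ltr_wpDr// sumr_ge0// => j _; exact: ltW.
Qed.

(** Jensen's inequality for [x ^ d]: bound each [R i ^ d] below by the tangent
    at the mean; the linear terms cancel in the sum. *)
Lemma card_powR_mean_le (K : realType) (I : finType) (R : I -> K) (d : K) :
  (0 < #|I|)%N -> (forall i, 0 < R i) -> d = 0 \/ 1 <= d ->
  #|I|%:R * (#|I|%:R^-1 * \sum_i R i) `^ d <= \sum_i R i `^ d.
Proof.
move=> I0 R0 [->|d1].
  by rewrite powRr0 mulr1 (eq_bigr (fun=> 1)) ?sumr_const// => i _; rewrite powRr0.
have m0 := mean_gt0 _ _ _ I0 R0.
set N : K := #|I|%:R in m0 *; set m := N^-1 * _ in m0 *.
have N0 : 0 < N by rewrite ltr0n.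
have step i : m `^ d * (1 + d * (R i / m - 1)) <= R i `^ d.
  have Rm : R i = m * (R i / m) by rewrite mulrC divfK// gt_eqF.
  rewrite [in leRHS]Rm (powRM (x := m)) ?divr_ge0 ?(ltW (R0 i)) ?(ltW m0)// ler_wpM2l ?powR_ge0//.
  by rewrite powR_bernoulli// divr_ge0 ?ltW.
apply: le_trans (ler_sum _ (fun i _ => step i)).
rewrite -mulr_sumr big_split/= sumr_const -mulr_sumr sumrB -mulr_suml sumr_const.
have -> : \sum_i R i = N * m by rewrite /m mulrA divff ?mul1r// gt_eqF.
by rewrite -/N mulfK ?gt_eqF// subrr mulr0 addr0 mulrC.
Qed.

(** The bound of the theorem for the dimension of any doubling space [X] into
    which the index set is mapped; taking a map [f] rather than a subset of [X]
    lets the same points be viewed in [A] and in [Omega]. *)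
Lemma card_le_powR_ddim (K : realType) (X : metricType K) (I : finType)
    (f : I -> X) (R : I -> K) (x : X) (r : K) :
  doubling X -> (0 < #|I|)%N -> (forall i, 0 < R i) ->
  (forall i j, i != j -> R i < mdist (f i) (f j)) -> 0 < r ->
  (forall i, cball x r (f i)) -> (forall i, R i <= 4 * r) ->
  #|I|%:R <= (4 * r / (#|I|%:R^-1 * \sum_i R i)) `^ ddim X.
Proof.
move=> dX I0 R0 sepR r0 fx R4.
(* Deep enough that [2 * r / 2 ^ n] is below every [R i]. *)
pose n := \max_i Num.bound (2 * r / R i).
have kraft : \sum_i R i `^ ddim X <= (4 * r) `^ ddim X.
  apply: (@sum_powR_le _ X _ _ _ f R (doubling_constP _ _ dX) (powR_ddim _ _ x dX)
    (ddim_ge0 _ _ x dX) R0 sepR n _ x r r0) => // i _.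
  by rewrite -ler_pdivrMr// ltW// upper_nthrootP// leq_bigmax.
have m0 := mean_gt0 _ _ _ I0 R0; set m := _ * \sum_i _ in m0 *.
have md0 : 0 < m `^ ddim X by rewrite powR_gt0.
rewrite -(ler_pM2r md0) -powRM ?(ltW m0) ?divr_ge0 ?(ltW m0) ?mulr_ge0 ?(ltW r0)//.
rewrite divfK ?gt_eqF//; apply: le_trans kraft.
exact: (card_powR_mean_le _ _ _ _ I0 R0 (ddim_dichotomy _ _ x dX)).
Qed.

Lemma mdist_le_diam (K : realType) (T : metricType K) (A : {fset T}) (a b : A) :
  mdist a b <= diam [set` A].
Proof.
apply: ub_le_sup; last by exists (val a, val b) => //; split; exact: fsvalP.
exists (\big[Num.max/0]_(p : A * A) mdist p.1 p.2) => _ [[u v] /= [Au Av] <-].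
exact: (le_bigmax _ (fun p : A * A => mdist p.1 p.2) ([` Au], [` Av])%fset).
Qed.

Theorem theorem1p1 (K : realType) (Omega : metricType K)
    (dOmega : doubling Omega) (A : {fset Omega}) (A0 : A != fset0)
    (R : A -> K) (R0 : forall a : A, 0 < R a) (sepR : radius_separated R) :
  #|` A|%:R <=
    (5 * diam [set` A] / avg_radius R) `^ Num.min (ddim A) (ddim Omega).
Proof.
have dA : doubling A by exists #|` A|; exact: doubling_finite.
have [x Ax] := fset0Pn _ A0; pose a0 : A := [` Ax]%fset.
have sep (a b : A) : a != b -> R a < mdist a b.
  move=> ab; rewrite -lte_fin; apply: lt_le_trans (sepR a) _.
  by apply: ereal_inf_lbound; exists b => //=; rewrite eq_sym.
have cardA : (0 < #|{: A}|)%N by apply/card_gt0P; exists a0.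
have ddimA0 := ddim_ge0 _ _ a0 dA; have ddimO0 := ddim_ge0 _ _ x dOmega.
have [card1|] := leqP #|` A| 1.
  have ddimA : ddim A = 0.
    have := doubling_const_le _ _ _ (doubling_finite _ _ A) => /leq_trans/(_ card1).
    have := doubling_with_gt0 _ _ _ a0 (doubling_constP _ _ dA).
    by rewrite /ddim; case: (doubling_const A) => [|[|]]// _ _; rewrite ln1 mul0r.
  by rewrite ddimA min_l// powRr0 -[1]/(1%:R) ler_nat.
rewrite cardfE => card2.
have near (a : A) : R a <= diam [set` A].
  have [b ab] : exists b, a != b.
    have /card_gt0P[b] : (0 < #|predC1 a|)%N.
      by rewrite cardC1 -subn1 subn_gt0.
    by rewrite inE eq_sym; exists b.
  exact: le_trans (ltW (sep a b ab)) (mdist_le_diam _ _ _ a b).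
have diam0 : 0 < diam [set` A] := lt_le_trans (R0 a0) (near a0).
have R4 a : R a <= 4 * diam [set` A] by have := near a; lra.
have bound (X : metricType K) (f : A -> X) : doubling X ->
    (forall a b, mdist (f a) (f b) = mdist a b) ->
    #|{: A}|%:R <= (5 * diam [set` A] / avg_radius R) `^ ddim X.
  move=> dX fE.
  have := @card_le_powR_ddim K X A f R (f a0) (diam [set` A]) dX cardA R0.
  rewrite -cardfE -/(avg_radius R) => /(_ _ diam0 _ R4) h.
  apply: le_trans (h _ _) _.
  - by move=> a b ab; rewrite fE sep.
  - by move=> a; rewrite /cball/= fE mdist_le_diam.
  have avg0 : 0 <= avg_radius R.
    by rewrite mulr_ge0 ?invr_ge0// sumr_ge0// => a _; exact: ltW.
  have dimX := ddim_ge0 _ _ (f a0) dX.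
  rewrite (ge0_ler_powR dimX) ?nnegrE ?mulr_ge0 ?invr_ge0 ?(ltW diam0)//.
  by rewrite ler_wpM2r ?invr_ge0// ler_wpM2r ?ler_nat// ltW.
by rewrite minEle; case: ifP => _; [exact: (bound A id)|exact: (bound Omega val)].
Qed.
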